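(* Let $i$ be a positive integer, and define the $2\times4$, $4\times4$, $4\times 4$ matrices \[ A=\begin{bmatrix}1&1&1&1\\1&1&-1&-1\end{bmatrix},\quad B=\begin{bmatrix}1&1&0&0\\-1&-1&0&0\\0&0&1&1\\0&0&-1&-1\end{bmatrix},\quad C=\begin{bmatrix}0&0&-1&1\\0&0&1&-1\\1&-1&0&0\\-1&1&0&0\end{bmatrix}. \] Let $S$ be the $(4i+6)\times(4i+6)$ block matrix with block rows/columns of sizes $2,4,4,\dots,4$ ($i+2$ blocks in total) given by \[ S=\begin{bmatrix} 0 & A & 0 & \cdots & 0 & 0\\ -A^T & 0 & B & \cdots & 0 & 0\\ 0 & -B^T & 0 & \ddots & \vdots & \vdots\\ \vdots & & \ddots & \ddots & B & 0\\ 0 & \cdots & & -B^T & 0 & B\\ 0 & 0 & \cdots & 0 & -B^T & C \end{bmatrix} \] (i.e. the $(1,2)$ block is $A$, the $(2,1)$ block is $-A^T$, the $(k,k+1)$ blocks for $2\le k\le i+1$ are $B$, the $(k+1,k)$ blocks for $2\le k\le i+1$ are $-B^T$, the last diagonal block is $C$, and all other blocks are zero). Then $S$ is the skew-adjacency matrix of an orientation $\mathcal{G}_i^\sigma$ of $\mathcal{G}_i$, with rows/columns ordered $u,v,u_1,u_2,v_1,v_2,u_3,u_4,v_3,v_4,\dots,u_{2i+1},u_{2i+2},v_{2i+1},v_{2i+2}$, and $S^TS=4I$; that is, $\mathcal{G}_i^\sigma$ has optimum skew energy.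
   Context: For a simple graph $G$ on vertices $v_1,\dots,v_n$ with orientation $\sigma$, the skew-adjacency matrix $S(G^\sigma)=[s_{ij}]$ has $s_{ij}=1$, $s_{ji}=-1$ if $\langle v_i,v_j\rangle$ is an arc and $0$ for non-adjacent pairs. Optimum skew energy means the sum of absolute values of the eigenvalues of $S(G^\sigma)$ equals $n\sqrt{\Delta}$ ($\Delta$ the maximum degree), equivalently $S^TS=\Delta I_n$. $\mathcal{G}_i$ is the graph on vertices $u,v,u_1,\dots,u_{2i+2},v_1,\dots,v_{2i+2}$: $u,v$ each adjacent to $u_1,u_2,v_1,v_2$; for $k=1,\dots,i$, each of $u_{2k-1},u_{2k}$ adjacent to each of $u_{2k+1},u_{2k+2}$ and each of $v_{2k-1},v_{2k}$ adjacent to each of $v_{2k+1},v_{2k+2}$; plus edges $u_{2i+1}v_{2i+2},v_{2i+2}u_{2i+2},u_{2i+2}v_{2i+1},v_{2i+1}u_{2i+1}$. *)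

(* Defs.v *)
From HB Require Import structures.
From mathcomp Require Import all_boot all_order all_algebra.
From mathcomp Require Import zify.

Set Implicit Arguments.
Unset Strict Implicit.
Unset Printing Implicit Defensive.

Import Order.TTheory GRing.Theory Num.Theory.
Local Open Scope ring_scope.

Record sgraph := SGraph {
  vertex :> finType;
  adj : rel vertex;
  adj_sym : symmetric adj;
  adj_irrefl : irreflexive adj
}.

Definition degree (G : sgraph) (x : G) : nat := #|[pred y | adj x y]|.

Definition max_degree (G : sgraph) : nat := \max_(x : G) degree x.

(* [arc x y] means that the edge xy is directed from x to y. *)
Record orientation (G : sgraph) := Orientation {
  arc :> rel G;
  arc_edge : forall x y, arc x y || arc y x = adj x y;
  arc_asym : forall x y, arc x y -> ~~ arc y x
}.

(* [f] lists the vertices in the order in which they label rows and columns. *)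
Definition skew_adj (G : sgraph) (s : orientation G) (n : nat) (f : 'I_n -> G) :
    'M[int]_n :=
  \matrix_(k, l) if s (f k) (f l) then 1 else if s (f l) (f k) then -1 else 0.

(* The eigenvalues of M in F, repeated according to algebraic multiplicity:
   char_poly M is monic, so it is the product of the 'X - z over this list. *)
Definition eigenvalues (F : numClosedFieldType) (n : nat) (M : 'M[F]_n) : seq F :=
  sval (closed_field_poly_normal (char_poly M)).

Definition skew_energy (F : numClosedFieldType) (G : sgraph) (s : orientation G) : F :=
  \sum_(z <- eigenvalues (map_mx intr (skew_adj s (@enum_val G predT)))) `|z|.

Definition optimum_skew_energy (F : numClosedFieldType) (G : sgraph)
    (s : orientation G) : Prop :=
  skew_energy F s = #|G|%:R * sqrtC (max_degree G)%:R.

(* Vertices of the graph G_i: (false, j) is u_j and (true, j) is v_j for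
   1 <= j <= 2i+2, while (false, 0) and (true, 0) are u and v. *)
Definition Gvertex (i : nat) : Type := (bool * 'I_(2 * i + 3))%type.

Section EdgeList.
Local Open Scope nat_scope.

Definition u_ (j : nat) : bool * nat := (false, j).
Definition v_ (j : nat) : bool * nat := (true, j).

Definition Gedges (i : nat) : seq ((bool * nat) * (bool * nat)) :=
  [seq (x, y) | x <- [:: u_ 0; v_ 0], y <- [:: u_ 1; u_ 2; v_ 1; v_ 2]] ++
  flatten [seq
    [seq (u_ a, u_ b) | a <- [:: 2 * k - 1; 2 * k], b <- [:: 2 * k + 1; 2 * k + 2]] ++
    [seq (v_ a, v_ b) | a <- [:: 2 * k - 1; 2 * k], b <- [:: 2 * k + 1; 2 * k + 2]]
    | k <- iota 1 i] ++
  [:: (u_ (2 * i + 1), v_ (2 * i + 2)); (v_ (2 * i + 2), u_ (2 * i + 2));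
      (u_ (2 * i + 2), v_ (2 * i + 1)); (v_ (2 * i + 1), u_ (2 * i + 1))].

Definition Gadj (i : nat) (x y : Gvertex i) : bool :=
  let lx := (x.1, x.2 : nat) in
  let ly := (y.1, y.2 : nat) in
  ((lx, ly) \in Gedges i) || ((ly, lx) \in Gedges i).

Lemma Gadj_sym (i : nat) : symmetric (@Gadj i).
Proof. by move=> x y; rewrite /Gadj orbC. Qed.

Lemma Gadj_irrefl (i : nat) : irreflexive (@Gadj i).
Proof.
have /allP neq : all (fun e => e.1 != e.2) (Gedges i).
  rewrite /Gedges !all_cat; apply/and3P; split.
  - by [].
  - apply/allP=> e /flattenP[s /mapP[k]]; rewrite mem_iota => /andP[k_gt0 _] ->.
    by rewrite mem_cat !inE !orbA; do ![case/orP]; move=> /eqP->;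
      rewrite xpair_eqE /=; lia.
  - by [].
by move=> x; apply/negbTE/negP; rewrite /Gadj orbb => /neq; rewrite /= eqxx.
Qed.

End EdgeList.

Definition Ggraph (i : nat) : sgraph := SGraph (@Gadj_sym i) (@Gadj_irrefl i).

(* The listing u, v, u_1, u_2, v_1, v_2, u_3, u_4, v_3, v_4, ...: position
   4q + r + 2 (with r < 4) carries u_(2q+1), u_(2q+2), v_(2q+1), v_(2q+2)
   for r = 0, 1, 2, 3. *)
Definition Glabel (m : nat) : bool * nat :=
  match m with
  | 0 => u_ 0
  | 1 => v_ 0
  | t.+2 =>
      let q := (t %/ 4)%N in
      nth (u_ 0) [:: u_ (2 * q + 1); u_ (2 * q + 2);
                     v_ (2 * q + 1); v_ (2 * q + 2)]%N (t %% 4)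
  end.

Lemma Glabel_lt (i : nat) (m : 'I_(4 * i + 6)) : ((Glabel m).2 < 2 * i + 3)%N.
Proof.
case: m => [[|[|t]] /= t_lt]; try lia.
have: (t %% 4 < 4)%N by rewrite ltn_pmod.
by case: (t %% 4)%N => [|[|[|[|r]]]] //= _; lia.
Qed.

Definition Gorder (i : nat) (m : 'I_(4 * i + 6)) : Ggraph i :=
  ((Glabel m).1, Ordinal (Glabel_lt m)).

Definition mx_of_rows (m n : nat) (rows : seq (seq int)) : 'M[int]_(m, n) :=
  \matrix_(k, l) (nth [::] rows k)`_l.

Definition blockA : 'M[int]_(2, 4) := mx_of_rows 2 4
  [:: [:: 1; 1;  1;  1];
      [:: 1; 1; -1; -1]].

Definition blockB : 'M[int]_4 := mx_of_rows 4 4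
  [:: [::  1;  1;  0;  0];
      [:: -1; -1;  0;  0];
      [::  0;  0;  1;  1];
      [::  0;  0; -1; -1]].

Definition blockC : 'M[int]_4 := mx_of_rows 4 4
  [:: [::  0;  0; -1;  1];
      [::  0;  0;  1; -1];
      [::  1; -1;  0;  0];
      [:: -1;  1;  0;  0]].

Definition block_size (k : nat) : nat := if k is 0 then 2 else 4.

(* Block indices start at 0, so the last block row and column is i + 1. *)
Definition Sblock (i k l : nat) : 'M[int]_(block_size k, block_size l) :=
  match k, l with
  | 0, 1 => blockA
  | 1, 0 => - blockA^T
  | k'.+1, l'.+1 =>
      if l' == k'.+1 then blockB
      else if k' == l'.+1 then - blockB^T
      else if (k' == i) && (l' == i) then blockC
      else 0
  | _, _ => 0
  end.

Lemma sum_block_size (i : nat) : (\sum_(k < i.+2) block_size k = 4 * i + 6)%N.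
Proof.
by rewrite big_ord_recl /= sum_nat_const card_ord mulnC mulnS addnA addnC.
Qed.

Definition Smatrix (i : nat) : 'M[int]_(4 * i + 6) :=
  castmx (sum_block_size i, sum_block_size i)
    (\mxblock_(k < i.+2, l < i.+2) Sblock i k l).

(* Main.v *)
(* The block products AB, BB, BC and C B^T vanish, while A A^T,
   A^T A + B B^T, B^T B + B B^T and B^T B - C C all equal 4I; as S is
   skew-symmetric and block tridiagonal, this gives S^T S = - S S = 4I.
   The absolute values of the entries of S are the adjacencies of G_i, so the
   signs of S define an orientation with skew-adjacency matrix S.  Finally
   S^T S = dI makes every degree equal to d and every eigenvalue a square root
   of -d, so that the skew energy is n sqrt d. *)

Require Import Defs.
From mathcomp Require Import all_boot all_order all_algebra.
From mathcomp Require Import zify.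

Set Implicit Arguments.
Unset Strict Implicit.
Unset Printing Implicit Defensive.

Import Order.TTheory GRing.Theory Num.Theory.
Local Open Scope ring_scope.

(** * Skew-adjacency matrices, orthogonality and optimum skew energy *)

Lemma tr_skew_adj (G : sgraph) (s : orientation G) (n : nat) (f : 'I_n -> G) :
  (skew_adj s f)^T = - skew_adj s f.
Proof.
apply/matrixP=> k l; rewrite !mxE.
case: ifP => [/arc_asym/negbTE -> | _]; first by [].
by case: ifP; rewrite ?opprK ?oppr0.
Qed.

Lemma skew_adj_sqr (G : sgraph) (s : orientation G) (n : nat) (f : 'I_n -> G)
    (k l : 'I_n) :
  skew_adj s f k l * skew_adj s f k l = (adj (f k) (f l))%:R.
Proof. by rewrite mxE -(arc_edge s); case: (s _ _); case: (s _ _). Qed.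

(** Changing the listing permutes rows and columns simultaneously by [f' \o g]. This passes from the
    order in which [Smatrix] is written to the enumeration used by [skew_energy]. *)
Lemma skew_adj_reindex (G : sgraph) (s : orientation G) (n p : nat)
    (f : 'I_n -> G) (g : 'I_p -> G) (d : int) :
    bijective f -> bijective g ->
    (skew_adj s f)^T *m skew_adj s f = d%:M ->
  (skew_adj s g)^T *m skew_adj s g = d%:M.
Proof.
move=> [f' fK f'K] bij_g; have [g' gK g'K] := bij_g; move/matrixP=> Sf.
apply/matrixP=> k l; have := Sf (f' (g k)) (f' (g l)).
rewrite !mxE (inj_eq (can_inj f'K)) (inj_eq (can_inj gK)) => <-.
rewrite (reindex (f' \o g)) /=; last first.
  by exists (g' \o f) => x _ /=; rewrite ?f'K ?gK ?g'K ?fK.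
by apply: eq_bigr => z _; rewrite !mxE !f'K.
Qed.

Lemma degree_of_orthogonal (G : sgraph) (s : orientation G) (n : nat)
    (f : 'I_n -> G) (d : nat) :
    bijective f -> (skew_adj s f)^T *m skew_adj s f = d%:R%:M ->
  forall x : G, degree x = d.
Proof.
move=> [g fK gK] Sf x; have /matrixP/(_ (g x) (g x)) := Sf.
(* Skew symmetry turns S^T S into S S^T, whose diagonal entry at [g x] is the sum of squares along
   that row, i.e. the number of neighbours of [x]. *)
rewrite tr_skew_adj mulNmx -mulmxN -tr_skew_adj !mxE eqxx mulr1n.
under eq_bigr => l _ do rewrite [X in _ * X]mxE skew_adj_sqr gK.
rewrite -natr_sum => /eqP; rewrite eqr_nat => /eqP <-.
rewrite /degree -sum1_card big_mkcond /= (reindex f) /=; last first.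
  by exists g => y _.
by apply: eq_bigr => l _; rewrite inE; case: (adj _ _).
Qed.

Lemma optimum_of_orthogonal (F : numClosedFieldType) (G : sgraph)
    (s : orientation G) (n : nat) (f : 'I_n -> G) (d : nat) :
    bijective f -> (skew_adj s f)^T *m skew_adj s f = d%:R%:M ->
  optimum_skew_energy F s.
Proof.
move=> bij_f Sf; rewrite /optimum_skew_energy /skew_energy /eigenvalues.
have bij_e : bijective (@enum_val G predT).
  by exists enum_rank; [exact: enum_valK | exact: enum_rankK].
have Se := skew_adj_reindex bij_f bij_e Sf.
set e := @enum_val G predT in bij_e Se *; set M := map_mx _ _.
have MM : M *m M = (- d%:R)%:M.
  rewrite -map_mxM -[X in X *m _]opprK -tr_skew_adj mulNmx Se map_mxN.
  by rewrite map_scalar_mx rmorph_nat raddfN.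
case: closed_field_poly_normal => r /=.
rewrite (monicP (char_poly_monic M)) scale1r => Mr.
have size_r : size r = #|G|.
  by have := size_char_poly M; rewrite Mr size_prod_XsubC => -[->].
have max_d : #|G|%:R * sqrtC (max_degree G)%:R = #|G|%:R * sqrtC d%:R :> F.
  (* On an empty vertex set [max_degree] is 0 and may differ from [d], but the factor [#|G|] then
     kills both sides. *)
  have [x _ | G0] := pickP G; last by rewrite eq_card0 // !mul0r.
  congr (_ * sqrtC _%:R); apply/eqP; rewrite eqn_leq.
  have degG := degree_of_orthogonal bij_f Sf.
  rewrite -{2}(degG x) leq_bigmax andbT.
  by apply/bigmax_leqP=> y _; rewrite degG.
rewrite max_d (eq_big_seq (fun=> sqrtC d%:R)) => [|z zr].
  by rewrite big_const_seq count_predT iter_addr_0 size_r -[LHS]mulr_natl.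
have /eigenvalueP[v vM v0] : eigenvalue M z.
  by rewrite eigenvalue_root_char Mr root_prod_XsubC.
(* Applying M twice to the eigenvector [v] scales it by both [z ^+ 2] and -d, and [v] is nonzero. *)
have zz : z ^+ 2 = - d%:R.
  apply/eqP; rewrite -subr_eq0; apply: contraNT v0.
  have : (z ^+ 2 - - d%:R) *: v = 0.
    rewrite scalerBl expr2 -scalerA -vM scalemxAl -vM -mulmxA MM mul_mx_scalar.
    by rewrite subrr.
  by move/eqP; rewrite scaler_eq0 => /orP[->|].
by rewrite -[LHS]sqrCK ?normr_ge0 // -normrX zz normrN normr_nat.
Qed.

(** Arcs are the entries equal to 1. An edge has entry 1 or -1, so by skew symmetry exactly one of
    its two directions is an arc. *)
Lemma orientation_of_skew (G : sgraph) (n : nat) (f : 'I_n -> G)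
    (S : 'M[int]_n) :
    bijective f -> S^T = - S ->
    (forall k l, `|S k l| = (adj (f k) (f l))%:R) ->
  exists s : orientation G, S = skew_adj s f.
Proof.
move=> [g fK gK] /matrixP skewS normS.
have SC k l : S l k = - S k l by have := skewS k l; rewrite !mxE.
have arcE x y :
    (S (g x) (g y) == 1) || (S (g y) (g x) == 1) = adj x y.
  have := normS (g x) (g y); rewrite !gK (SC (g x) (g y)).
  by case: adj => /=; lia.
have arcA x y : S (g x) (g y) == 1 -> ~~ (S (g y) (g x) == 1).
  by rewrite (SC (g x)) => /eqP->.
exists (Orientation arcE arcA); apply/matrixP=> k l.
rewrite mxE /= !fK (SC k l).
by have := normS k l; case: adj => /=; do 2?case: ifP; lia.
Qed.

(** * The vertex ordering and the edges in block coordinates *)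

Definition label_index (x : bool * nat) : nat :=
  if x.2 is j.+1 then (4 * j./2 + 2 * x.1 + odd j + 2)%N else x.1.

(** For index [j.+1], [j./2] recovers the quotient q, while [2 * x.1 + odd j] recovers the remainder
    r; the final 2 skips u and v. *)
Lemma GlabelK : cancel Glabel label_index.
Proof.
case=> [|[|t]] //=; have: (t %% 4 < 4)%N by rewrite ltn_pmod.
case E: (t %% 4)%N => [|[|[|[|r]]]] //= _;
  rewrite /label_index /= ?addn1 ?addn2 /=; lia.
Qed.

Lemma Gorder_bij (i : nat) : bijective (@Gorder i).
Proof.
apply: inj_card_bij => [k l [eq1 eq2]|].
  apply/val_inj/(can_inj GlabelK).
  by case: (Glabel k) (Glabel l) eq1 eq2 => ? ? [? ?] /= -> ->.
by rewrite card_prod card_bool !card_ord; lia.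
Qed.

Definition block_label (k r : nat) : bool * nat :=
  if k is q.+1 then ((1 < r)%N, (2 * q + odd r + 1)%N) else (r == 1%N, 0%N).

Lemma Glabel_block (k r : nat) :
    (r < block_size k)%N ->
  Glabel (\sum_(0 <= l < k) block_size l + r) = block_label k r.
Proof.
case: k => [|q] r_lt; first by rewrite big_geq // add0n; case: r r_lt => [|[|]].
rewrite big_nat_recl // sum_nat_const_nat subn0 /=.
have -> : ((0 + q * 4 + r) %/ 4 = q)%N by rewrite /= in r_lt; lia.
have -> : ((0 + q * 4 + r) %% 4 = r)%N by rewrite /= in r_lt; lia.
by case: r r_lt => [|[|[|[|r]]]] //= _; rewrite /u_ /v_; congr (_, _); lia.
Qed.

(** The three disjuncts match the three pieces of the edge list, each edge in its listed direction
    only. In a block of size 4, rows 0 and 1 are u's and rows 2 and 3 are v's, so [r./2 == t./2]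
    keeps an edge on one side. *)
Lemma mem_Gedges (i k r l t : nat) :
    (k < i.+2)%N -> (l < i.+2)%N ->
    (r < block_size k)%N -> (t < block_size l)%N ->
  ((block_label k r, block_label l t) \in Gedges i) =
  [|| (k == 0) && (l == 1), [&& 0 < k, l == k.+1 & r./2 == t./2] |
      [&& k == i.+1, l == i.+1 &
          (r, t) \in [:: (0, 3); (3, 1); (1, 2); (2, 0)]]]%N.
Proof.
move=> k_lt l_lt r_lt t_lt; rewrite !mem_cat; congr [|| _, _ | _].
- case: k k_lt r_lt => [|k] _; case: r => [|[|[|[|r]]]] //= _;
  case: l l_lt t_lt => [|[|l]] _; case: t => [|[|[|[|t]]]] //= _;
  rewrite /= !inE ?in_nil ?xpair_eqE /=; lia.
- apply/idP/idP.
    case/flattenP=> e /mapP[j]; rewrite mem_iota => j_lt ->.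
    rewrite mem_cat !inE !orbA /block_label.
    by case: k k_lt r_lt => [|k] _; case: r => [|[|[|[|r]]]] //= _;
       case: l l_lt t_lt => [|l] _; case: t => [|[|[|[|t]]]] //= _;
       rewrite !xpair_eqE /=; lia.
  case/and3P=> k_gt0 /eqP def_l /eqP rt; apply/flattenP.
  (* Block [k] carries the indices 2k-1 and 2k, so the group numbered [k] joins it to block
     [k.+1]. *)
  eexists; first by apply/mapP; exists k; [rewrite mem_iota; lia | reflexivity].
  case: k k_gt0 r_lt def_l {k_lt} => // k _ r_lt def_l.
  rewrite def_l /= in t_lt l_lt *.
  rewrite ?mem_cat !inE ?in_nil !xpair_eqE /=.
  by case: r r_lt rt => [|[|[|[|r]]]] //= _;
     case: t t_lt => [|[|[|[|t]]]] //= _ _; lia.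
- rewrite !inE.
  by case: k k_lt r_lt => [|k] _; case: r => [|[|[|[|r]]]] //= _;
     case: l l_lt t_lt => [|l] _; case: t => [|[|[|[|t]]]] //= _;
     rewrite !xpair_eqE /=; lia.
Qed.

(** * Block identities and the square of S *)

Lemma mul_castmx_sq (R : pzSemiRingType) (m n : nat) (e : m = n)
    (A B : 'M[R]_m) :
  castmx (e, e) A *m castmx (e, e) B = castmx (e, e) (A *m B).
Proof. by case: n / e; rewrite !castmx_id. Qed.

Lemma castmx_scalar (R : pzSemiRingType) (m n : nat) (e : m = n) (a : R) :
  castmx (e, e) a%:M = a%:M.
Proof. by case: n / e; rewrite castmx_id. Qed.

Lemma castmxN (V : zmodType) (m n : nat) (e : m = n) (A : 'M[V]_m) :
  castmx (e, e) (- A) = - castmx (e, e) A.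
Proof. by case: n / e; rewrite !castmx_id. Qed.

Ltac entrywise :=
  apply/matrixP; do 2![case=> [[|[|[|[|?]]]] ?] //];
  rewrite !mxE ?big_ord_recl ?big_ord0 /= ?mxE /=.

Lemma blockA_trA : blockA *m blockA^T = 4%:M.
Proof. by entrywise. Qed.
Lemma blockAB : blockA *m blockB = 0.
Proof. by entrywise. Qed.
Lemma blockBB : blockB *m blockB = 0.
Proof. by entrywise. Qed.
Lemma blockBC : blockB *m blockC = 0.
Proof. by entrywise. Qed.
Lemma block_trA_A_B_trB : blockA^T *m blockA + blockB *m blockB^T = 4%:M.
Proof. by entrywise. Qed.
Lemma block_trB_B_B_trB : blockB^T *m blockB + blockB *m blockB^T = 4%:M.
Proof. by entrywise. Qed.
Lemma block_trB_B_CC : blockB^T *m blockB - blockC *m blockC = 4%:M.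
Proof. by entrywise. Qed.
Lemma tr_blockC : blockC^T = - blockC.
Proof. by entrywise. Qed.
Lemma blockC_trB : blockC *m blockB^T = 0.
Proof. by entrywise. Qed.

(** [F] is a sum of point masses at k-1, k and k+1. The conditionals drop the neighbour missing in
    the first or last row. *)
Lemma sum_tridiagonal (V : nmodType) (n k : nat) (F : nat -> V) :
    (k < n)%N -> (forall j, (j.+1 < k)%N || (k.+1 < j)%N -> F j = 0) ->
  \sum_(j < n) F j = (if k is k'.+1 then F k' else 0) + F k +
                     (if (k.+1 < n)%N then F k.+1 else 0).
Proof.
move=> k_lt F0; rewrite -(big_mkord xpredT) /=.
pose at_ l j := if j == l then F j else 0.
have F_split j :
    F j = (if k is k'.+1 then at_ k' j else 0) + at_ k j + at_ k.+1 j.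
  have [/F0 Fj|] := boolP ((j.+1 < k)%N || (k.+1 < j)%N).
    by rewrite /at_ Fj; case: k {k_lt F0} => *; rewrite !if_same ?addr0.
  rewrite /at_; case: k {k_lt F0} => [|k] j_near.
    by case: j j_near => [|[|j]] //= _; rewrite ?addr0 ?add0r.
  have [->|[->|->]] : j = k \/ j = k.+1 \/ j = k.+2 by lia.
  - by rewrite eqxx; do 2![case: eqP => [|_]; first lia]; rewrite !addr0.
  - by rewrite eqxx; do 2![case: eqP => [|_]; first lia]; rewrite addr0 add0r.
  - by rewrite eqxx; do 2![case: eqP => [|_]; first lia]; rewrite !add0r.
have sum_at l : \sum_(0 <= j < n) at_ l j = if (l < n)%N then F l else 0.
  by rewrite -big_mkcond /= big_nat1_eq.
rewrite (eq_bigr _ (fun j _ => F_split j)) !big_split /= !sum_at k_lt.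
case: k k_lt {F0 F_split} => [|k] k_lt; first by rewrite big1.
by rewrite sum_at ltnW.
Qed.

(** This and the next two lemmas trade the dependent match for boolean tests, which is possible
    because every block of positive index has size 4. *)
Lemma Sblock0S (i l : nat) : Sblock i 0 l.+1 = if l == 0 then blockA else 0.
Proof. by case: l. Qed.

Lemma SblockS0 (i k : nat) : Sblock i k.+1 0 = if k == 0 then - blockA^T else 0.
Proof. by case: k. Qed.

Lemma SblockSS (i k l : nat) :
  Sblock i k.+1 l.+1 =
  if l == k.+1 then blockB else if k == l.+1 then - blockB^T
  else if (k == i) && (l == i) then blockC else 0.
Proof. by case: k l => [|k] [|l]. Qed.

Lemma tr_Sblock (i k l : nat) : (Sblock i l k)^T = - Sblock i k l.
Proof.
case: k l => [|k] [|l]; rewrite ?Sblock0S ?SblockS0 ?SblockSS.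
- by rewrite trmx0 oppr0.
- by case: eqP => _; rewrite ?linearN /= ?trmxK ?trmx0 ?oppr0.
- by case: eqP => _; rewrite ?opprK ?trmx0 ?oppr0.
have [->|kl] := eqVneq k l.+1.
  by case: eqP => [|_]; [lia | rewrite opprK].
have [->|lk] := eqVneq l k.+1; first by rewrite linearN /= trmxK.
rewrite andbC; case: ifP => _; last by rewrite trmx0 oppr0.
exact: tr_blockC.
Qed.

(* The right-hand side is the (k, l) block of [\mxdiag_k (- 4%:M)]. *)
Lemma Sblock_sqr (i k l : nat) : (0 < i)%N -> (k < i.+2)%N -> (l < i.+2)%N ->
  \sum_(j < i.+2) (Sblock i k j *m Sblock i j l) =
  if k == l then conform_mx 0 (- 4%:M : 'M_(block_size k)) else 0.
Proof.
move=> i_gt0 k_lt l_lt.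
pose F j := Sblock i k j *m Sblock i j l.
rewrite (sum_tridiagonal (F := F) k_lt) /F; last first.
  (* The left factor alone vanishes away from the three diagonals, whatever [l] is. *)
  move=> {F} j far; suff -> : Sblock i k j = 0 by rewrite mul0mx.
  case: k k_lt far => [|k] k_lt; case: j => [|j] far;
    rewrite ?Sblock0S ?SblockS0 ?SblockSS //.
  - by case: eqP => //; lia.
  - by case: eqP => //; lia.
  - by do 3?[case: ifP => ?; first by lia].
(* Row 0 involves only A, row 1 both A and B, and later rows only B and C, hence the split into 0, 1
   and at least 2. *)
rewrite {F} !ltnS; case: k k_lt => [|[|k]] k_lt; case: l l_lt => [|[|l]] l_lt.
all: rewrite ?Sblock0S ?SblockS0 ?SblockSS ?eqSS ?eqxx ?conform_mx_id.
all: do ?[match goal with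
  |- context [?a == ?b :> nat] => case: (@eqP nat a b) => ?
  end; try (exfalso; lia)].
all: rewrite ?andbF /=.
all: try lia.
all: rewrite ?mul0mx ?mulmx0 ?if_same ?add0r ?addr0 ?mulmxN ?mulNmx.
all: rewrite -?trmx_mul ?blockA_trA ?blockAB ?blockBB ?blockBC ?blockC_trB.
all: rewrite ?trmx0 ?mulmx0 ?oppr0 ?if_same ?oppr0 ?add0r ?addr0 //.
(* Three diagonal blocks remain: block 1, which has a right neighbour as [0 < i]; the last block,
   which contains C; and the interior ones. *)
- by rewrite i_gt0 -opprD block_trA_A_B_trB.
- have -> : (k.+1 < i)%N = false by lia.
  by rewrite addr0 -block_trB_B_CC opprB addrC.
- have -> : (k.+1 < i)%N by lia.
  by rewrite -opprD block_trB_B_B_trB.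
Qed.

Lemma tr_Smatrix (i : nat) : (Smatrix i)^T = - Smatrix i.
Proof.
rewrite /Smatrix trmx_cast tr_mxblock -castmxN -mxblockN /=.
by congr castmx; apply: eq_mxblock => k l; rewrite tr_Sblock.
Qed.

Lemma Smatrix_orthogonal (i : nat) : (0 < i)%N ->
  (Smatrix i)^T *m Smatrix i = 4%:M.
Proof.
move=> i_gt0; rewrite tr_Smatrix mulNmx mul_castmx_sq mul_mxblock.
under eq_mxblock => k l do rewrite (Sblock_sqr i_gt0 (ltn_ord k) (ltn_ord l)).
rewrite -[mxblock _]/(\mxdiag_(k < i.+2) - 4%:M) mxdiagN mxdiagZ.
by rewrite castmxN castmx_scalar opprK.
Qed.

(** * Absolute values of the entries of S as adjacencies *)

Lemma norm_blockA (r : 'I_2) (t : 'I_4) : `|blockA r t| = 1.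
Proof. by case: r t => [[|[|[|r]]] ?] [[|[|[|[|t]]]] ?] //; rewrite mxE. Qed.

Lemma norm_blockB (r t : 'I_4) : `|blockB r t| = (r./2 == t./2)%:R.
Proof. by case: r t => [[|[|[|[|r]]]] ?] [[|[|[|[|t]]]] ?] //; rewrite mxE. Qed.

(** The closing 4-cycle is the complete bipartite graph between the two u's and the two v's of the
    last block. *)
Lemma norm_blockC (r t : 'I_4) : `|blockC r t| = (r./2 != t./2)%:R.
Proof. by case: r t => [[|[|[|[|r]]]] ?] [[|[|[|[|t]]]] ?] //; rewrite mxE. Qed.

(** The edge families of [mem_Gedges] are the supports of A, B and C; the reversed pair accounts for
    the transposed blocks below the diagonal. *)
Lemma norm_Sblock (i k l : nat)
    (r : 'I_(block_size k)) (t : 'I_(block_size l)) :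
    (k < i.+2)%N -> (l < i.+2)%N ->
  `|Sblock i k l r t| =
  (((block_label k r, block_label l t) \in Gedges i) ||
   ((block_label l t, block_label k r) \in Gedges i))%:R.
Proof.
move=> k_lt l_lt; rewrite !mem_Gedges //.
case: k l r t k_lt l_lt => [|k] [|l] r t k_lt l_lt.
- by rewrite mxE normr0.
- rewrite Sblock0S; case: l t l_lt => [|l] t l_lt /=;
    last by rewrite mxE normr0 andbF.
  by rewrite norm_blockA.
- rewrite SblockS0; case: k r k_lt => [|k] r k_lt /=;
    last by rewrite mxE normr0 andbF.
  by rewrite mxE mxE normrN norm_blockA orbT.
rewrite SblockSS /= !eqSS.
have [-> | kl] := eqVneq l k.+1.
  rewrite norm_blockB; congr (nat_of_bool _)%:R; lia.
have [-> | lk] := eqVneq k l.+1.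
  rewrite mxE mxE normrN norm_blockB; congr (nat_of_bool _)%:R; lia.
case: andP => [[/eqP -> /eqP ->] | nki].
  rewrite norm_blockC !inE !xpair_eqE !eqxx; congr (nat_of_bool _)%:R.
  by case: r t {k_lt l_lt} => [[|[|[|[|r]]]] ?] [[|[|[|[|t]]]] ?].
rewrite mxE normr0 /=; lia.
Qed.

Lemma norm_Smatrix (i : nat) (m n : 'I_(4 * i + 6)) :
  `|Smatrix i m n| = (adj (Gorder m) (Gorder n))%:R.
Proof.
rewrite castmxE mxE; set m' := cast_ord _ m; set n' := cast_ord _ n.
(* By [tagnat.rect], a position is the total size of the preceding blocks plus the offset in its own
   block, the form [Glabel_block] expects. *)
have label (x : 'I_(\sum_(k < i.+2) block_size k)) :
    Glabel x = block_label (tagnat.sig1 x) (tagnat.sig2 x).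
  rewrite -Glabel_block // {1}[x : nat]tagnat.rect.
  by rewrite big_mkord (big_ord_widen i.+2 block_size) // ltnW.
rewrite norm_Sblock // /Gorder /adj /= /Gadj /=.
(* The cast leaves the underlying number unchanged, so the labels are convertible. *)
have -> : (Glabel m) = Glabel m' by [].
have -> : (Glabel n) = Glabel n' by [].
by rewrite !label; case: (block_label _ _) (block_label _ _) => ? ? [? ?].
Qed.

Theorem theorem3p5 (F : numClosedFieldType) (i : nat) (hi : (0 < i)%N) :
  bijective (@Gorder i) /\
  exists s : orientation (Ggraph i),
    [/\ Smatrix i = skew_adj s (@Gorder i),
        (Smatrix i)^T *m Smatrix i = 4%:M
      & optimum_skew_energy F s].
Proof.
have bij_order := Gorder_bij i; split=> //.
have [s Ss] := orientation_of_skew bij_order (tr_Smatrix i) (@norm_Smatrix i).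
exists s; split; [exact: Ss | exact: Smatrix_orthogonal |].
apply: (optimum_of_orthogonal F (d := 4) bij_order).
by rewrite -Ss Smatrix_orthogonal.
Qed.
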